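(* Consider the Wasserstein distributionally robust problem described in the context, with Euclidean ground metric and loss $\ell(\boldsymbol x,\boldsymbol\xi)=L(\boldsymbol\xi^\top\boldsymbol x)$, where $L:\mathbb R\to\mathbb R_+$ is convex and Lipschitz with constant $\mathrm{Lip}(L)$. Let $\Xi=\mathbb R^k$, and let $\bar r:=\frac1N\sum_{i=1}^N\|\hat{\boldsymbol\xi}_i\|_2$ denote the effective diameter of the support. Then the additive suboptimality $\hat f_\rho-f^\star_\rho$ of the shrinkage path heuristic is at most $$\mathrm{Lip}(L)\left(\rho\left(1-\frac{\rho}{\bar r}\right)\|\boldsymbol x(0)\|_2+\frac{\rho^2}{\bar r}\|\boldsymbol x(\infty)\|_2\right)\qquad\forall\rho\in[0,\bar r],$$ which is maximized at $\rho=\bar r/2$ when $\boldsymbol x(\infty)=\boldsymbol 0$.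
   Context: Setting. The decision $\boldsymbol x$ and the uncertain vector $\boldsymbol\xi$ have the same dimension $k=n$. $\mathcal X\subseteq\mathbb R^n$ is closed and convex; $\Xi=\mathbb R^k$ is the support; $g_1,\dots,g_M$ are constraint functions with $g_m(\cdot,\boldsymbol\xi)$ closed convex for each $\boldsymbol\xi$, and $\gamma_1,\dots,\gamma_M\in\mathbb R$. The feasible set is $\mathcal X(\Xi)=\{\boldsymbol x\in\mathcal X: g_m(\boldsymbol x,\boldsymbol\xi)\le\gamma_m\ \forall\boldsymbol\xi\in\Xi,\ \forall m\in[M]\}$ with $[M]=\{1,\dots,M\}$, assumed non-empty. The empirical distribution is $\hat{\mathbb P}=\frac1N\sum_{i=1}^N\delta_{\hat{\boldsymbol\xi}_i}$ with samples $\hat{\boldsymbol\xi}_i\in\Xi$. The type-1 Wasserstein distance is $W(\mathbb Q,\hat{\mathbb P})=\inf_{\pi\in\Pi(\mathbb Q,\hat{\mathbb P})}\int\|\boldsymbol\xi-\boldsymbol\xi'\|_2\,\pi(\mathrm d\boldsymbol\xi,\mathrm d\boldsymbol\xi')$ ($\Pi$ = set of couplings), $\mathcal P(\Xi)$ is the set of probability measures on $\Xi$, and $\mathbb B_\rho(\hat{\mathbb P})=\{\mathbb Q\in\mathcal P(\Xi):W(\mathbb Q,\hat{\mathbb P})\le\rho\}$. Values. $f_\rho(\boldsymbol x)=\sup_{\mathbb Q\in\mathbb B_\rho(\hat{\mathbb P})}\mathbb E_{\mathbb Q}[\ell(\boldsymbol x,\tilde{\boldsymbol\xi})]$, and $f^\star_\rho$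 is the optimal value of minimizing $f_\rho$ over $\mathcal X(\Xi)$. $\boldsymbol x(0)$ is a fixed optimal solution of the sample average approximation problem $\min_{\boldsymbol x\in\mathcal X(\Xi)}\mathbb E_{\hat{\mathbb P}}[\ell(\boldsymbol x,\tilde{\boldsymbol\xi})]$, and $\boldsymbol x(\infty)$ is a fixed optimal solution of the robust optimization problem $\min_{\boldsymbol x\in\mathcal X(\Xi)}\sup_{\boldsymbol\xi\in\Xi}\ell(\boldsymbol x,\boldsymbol\xi)$; both problems are assumed to attain finite optimal values. The value of the shrinkage path heuristic is $\hat f_\rho=\min_{\lambda\in[0,1]}f_\rho((1-\lambda)\boldsymbol x(0)+\lambda\boldsymbol x(\infty))$. If $\bar r=0$ (so that $\rho=0$), the bound is read as $0$. *)

(* Defs.v *)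
From HB Require Import structures.
From mathcomp Require Import all_boot all_order all_algebra.
From mathcomp Require Import all_classical all_reals all_analysis.

Set Implicit Arguments.
Unset Strict Implicit.
Unset Printing Implicit Defensive.

Import Order.TTheory GRing.Theory Num.Theory numFieldNormedType.Exports.
Local Open Scope classical_set_scope.
Local Open Scope ring_scope.

(* R^n is 'cV[R]_n.  Its library norm `|x| is the max norm; this is used only
   through the topology it induces, the Euclidean norm being norm2 below. *)

Definition borel (R : realType) (n : nat) :=
  g_sigma_algebraType (@open 'cV[R]_n).
HB.instance Definition _ (R : realType) (n : nat) :=
  Measurable.on (borel R n).
HB.instance Definition _ (R : realType) (n : nat) :=
  Pointed.on (borel R n).

Definition dot (R : realType) (n : nat) (x y : 'cV[R]_n) : R :=
  (x^T *m y) 0 0.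

Definition norm2 (R : realType) (n : nat) (x : 'cV[R]_n) : R :=
  Num.sqrt (dot x x).

(* For extended-real-valued f, "closed" and "convex" are properties of the
   epigraph. *)
Definition epigraph (R : realType) (n : nat) (f : 'cV[R]_n -> \bar R) :
    set ('cV[R]_n * R^o) :=
  [set p | (f p.1 <= (p.2 : R)%:E)%E].

Definition closed_convex_function (R : realType) (n : nat)
    (f : 'cV[R]_n -> \bar R) : Prop :=
  closed (epigraph f) /\ convex_set (epigraph f).

Section empirical_measure.
Context (R : realType) (n N : nat) (xihat : 'I_N.+1 -> borel R n).
Local Open Scope ereal_scope.

(* The samples are indexed by 'I_N.+1, so that there is at least one. *)
Definition empirical (A : set (borel R n)) : \bar R :=
  (N.+1%:R^-1)%R%:E * \sum_(i < N.+1) \d_(xihat i) A.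

Let empiricalE :
  empirical = mscale ((N.+1%:R^-1)%:nng)%R
                (msum (fun k => \d_(xihat (inord k))) N.+1).
Proof.
apply/funext => A; rewrite /mscale /msum /empirical /=; congr (_ * _).
by apply: eq_bigr => i _; rewrite inord_val.
Qed.

Let empirical0 : empirical set0 = 0.
Proof. by rewrite empiricalE measure0. Qed.

Let empirical_ge0 A : 0 <= empirical A.
Proof. by rewrite empiricalE measure_ge0. Qed.

Let empirical_sigma_additive : semi_sigma_additive empirical.
Proof. by rewrite empiricalE; exact: measure_semi_sigma_additive. Qed.

HB.instance Definition _ := isMeasure.Build _ _ _ empirical
  empirical0 empirical_ge0 empirical_sigma_additive.

Let empirical_setT : empirical setT = 1.
Proof.
rewrite /empirical (eq_bigr (fun=> 1)) => [|i _]; last exact: diracT.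
by rewrite sumEFin sumr_const card_ord -EFinM mulVf.
Qed.

HB.instance Definition _ :=
  Measure_isProbability.Build _ _ _ empirical empirical_setT.

End empirical_measure.

Definition coupling (R : realType) (n : nat) (Q P : probability (borel R n) R)
    (pi : probability (borel R n * borel R n)%type R) : Prop :=
  forall A : set (borel R n), measurable A ->
    pi (fst @^-1` A) = Q A /\ pi (snd @^-1` A) = P A.

Definition wasserstein1 (R : realType) (n : nat)
    (Q P : probability (borel R n) R) : \bar R :=
  ereal_inf [set (\int[pi]_p (norm2 ((p.1 : 'cV[R]_n) - p.2))%:E)%E
            | pi in coupling Q P].

Definition wball (R : realType) (n : nat) (P : probability (borel R n) R)
    (rho : R) : set (probability (borel R n) R) :=
  [set Q | (wasserstein1 Q P <= rho%:E)%E].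

Definition wdro_cost (R : realType) (n : nat)
    (ell : 'cV[R]_n -> borel R n -> R) (P : probability (borel R n) R)
    (rho : R) (x : 'cV[R]_n) : \bar R :=
  ereal_sup [set 'E_Q[ell x] | Q in wball P rho]%E.

Definition robust_cost (R : realType) (n : nat)
    (ell : 'cV[R]_n -> borel R n -> R) (x : 'cV[R]_n) : \bar R :=
  ereal_sup [set (ell x xi)%:E | xi in [set: borel R n]].

Definition feasible (R : realType) (n M : nat) (X : set 'cV[R]_n)
    (g : 'I_M -> 'cV[R]_n -> 'cV[R]_n -> \bar R) (gamma : 'I_M -> R) :
    set 'cV[R]_n :=
  [set x | X x /\ forall xi m, (g m x xi <= (gamma m)%:E)%E].

Definition optimal_value (R : realType) (n : nat) (F : set 'cV[R]_n)
    (f : 'cV[R]_n -> \bar R) : \bar R :=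
  ereal_inf [set f x | x in F].

Definition optimal_solution (R : realType) (n : nat) (F : set 'cV[R]_n)
    (f : 'cV[R]_n -> \bar R) (x : 'cV[R]_n) : Prop :=
  [/\ F x, f x \is a fin_num & forall y, F y -> (f x <= f y)%E].

Definition shrinkage_path (R : realType) (n : nat) (x0 xinf : 'cV[R]_n) :
    set 'cV[R]_n :=
  [set (1 - lambda) *: x0 + lambda *: xinf | lambda in `[0, 1]].

Definition linear_loss (R : realType) (n : nat) (L : R -> R)
    (x : 'cV[R]_n) (xi : borel R n) : R :=
  L (dot xi x).

Definition mean_norm2 (R : realType) (n N : nat)
    (xihat : 'I_N.+1 -> borel R n) : R :=
  N.+1%:R^-1 * \sum_(i < N.+1) norm2 (xihat i).

(* When r = 0 the only rho in [0, r] is 0, and the value is 0 because every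
   summand carries a factor rho (whatever rho / 0 stands for). *)
Definition path_bound (R : realType) (n : nat) (K r : R) (x0 xinf : 'cV[R]_n)
    (rho : R) : R :=
  K * (rho * (1 - rho / r) * norm2 x0 + rho ^+ 2 / r * norm2 xinf).

(* Main.v *)
Require Import Defs.
From HB Require Import structures.
From mathcomp Require Import all_boot all_order all_algebra.
From mathcomp Require Import all_classical all_reals all_analysis.
From mathcomp Require Import measurable_realfun ring lra.
Import Order.TTheory GRing.Theory Num.Theory numFieldNormedType.Exports.

(* Finiteness of the robust value at x(oo) forces L(xi^T x(oo)) = L(0) for every
   xi, because a convex function that is bounded above on the line is constant.
   Take lambda = rho / rbar (Rocq's division gives 0 when rbar = 0) and let a be
   the optimal sample average value.
   - Integrating the convexity and Lipschitz estimates of L against a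
     near-optimal coupling gives, for x = (1 - lambda) x(0) + lambda x(oo),
       f_rho(x) <= (1 - lambda) a + lambda L(0)
                   + rho (1 - lambda) Lip(L) |x(0)|.
   - The mixture (1 - lambda) P + lambda delta_0 of the empirical distribution P
     with the Dirac mass at 0 is at distance at most lambda rbar = rho from P, so
     f_rho(y) >= (1 - lambda) a + lambda L(0) for every feasible y.
   The difference of the two is the first term of the bound, and the second term
   is nonnegative. *)

Set Implicit Arguments.
Unset Strict Implicit.
Unset Printing Implicit Defensive.

Local Open Scope classical_set_scope.
Local Open Scope ring_scope.

(** * Euclidean inner product and norm *)

Lemma dotE (R : realType) (n : nat) (x y : 'cV[R]_n) :
  dot x y = \sum_i x i 0 * y i 0.
Proof. by rewrite /dot mxE; apply: eq_bigr => i _; rewrite mxE. Qed.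

Lemma dot0r (R : realType) (n : nat) (x : 'cV[R]_n) : dot x 0 = 0.
Proof. by rewrite /dot mulmx0 mxE. Qed.

Lemma dot0l (R : realType) (n : nat) (x : 'cV[R]_n) : dot 0 x = 0.
Proof. by rewrite /dot trmx0 mul0mx mxE. Qed.

Lemma dotC (R : realType) (n : nat) (x y : 'cV[R]_n) : dot x y = dot y x.
Proof. by rewrite !dotE; apply: eq_bigr => i _; rewrite mulrC. Qed.

Lemma dotDr (R : realType) (n : nat) (x y z : 'cV[R]_n) :
  dot x (y + z) = dot x y + dot x z.
Proof. by rewrite /dot mulmxDr mxE. Qed.

Lemma dotZr (R : realType) (n : nat) (a : R) (x y : 'cV[R]_n) :
  dot x (a *: y) = a * dot x y.
Proof. by rewrite /dot -scalemxAr mxE. Qed.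

Lemma dot_ge0 (R : realType) (n : nat) (x : 'cV[R]_n) : 0 <= dot x x.
Proof. by rewrite dotE sumr_ge0// => i _; rewrite -expr2 sqr_ge0. Qed.

Lemma dot_eq0 (R : realType) (n : nat) (x : 'cV[R]_n) :
  (dot x x == 0) = (x == 0).
Proof.
apply/eqP/eqP => [|->]; last exact: dot0r.
rewrite dotE => /psumr_eq0P x0; apply/colP => i; rewrite mxE.
by apply/eqP; rewrite -sqrf_eq0 expr2 x0// => j _; rewrite -expr2 sqr_ge0.
Qed.

Lemma norm2_ge0 (R : realType) (n : nat) (x : 'cV[R]_n) : 0 <= norm2 x.
Proof. exact: sqrtr_ge0. Qed.

Lemma norm20 (R : realType) (n : nat) : norm2 (0 : 'cV[R]_n) = 0.
Proof. by rewrite /norm2 dot0r sqrtr0. Qed.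

Lemma norm2N (R : realType) (n : nat) (x : 'cV[R]_n) : norm2 (- x) = norm2 x.
Proof.
by rewrite /norm2 !dotE; congr Num.sqrt; apply: eq_bigr => i _; rewrite !mxE mulrNN.
Qed.

(** Cauchy-Schwarz, from the nonnegativity of the squared norm of one combination of [x] and [y]. *)
Lemma dot_norm2_le (R : realType) (n : nat) (x y : 'cV[R]_n) :
  `|dot x y| <= norm2 x * norm2 y.
Proof.
have [->|/negbTE y0] := eqVneq y 0; first by rewrite dot0r normr0 norm20 mulr0.
rewrite /norm2 -sqrtrM ?dot_ge0// -sqrtr_sqr ler_wsqrtr//.
have yy : 0 < dot y y by rewrite lt0r dot_eq0 y0 dot_ge0.
(* Up to the factor [dot y y], this vector is the component of [x] orthogonal to [y]. *)
have := dot_ge0 (dot y y *: x + (- dot x y) *: y).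
rewrite !(dotDr, dotZr) ![dot (_ + _) _]dotC !(dotDr, dotZr) (dotC y x).
set a := dot x x; set b := dot x y; move: (dot y y) yy => c yy.
rewrite (_ : _ + _ = c * (a * c - b ^+ 2)); last by ring.
by rewrite pmulr_rge0// subr_ge0.
Qed.

(** * Borel measurability of linear forms and of the distance *)

Lemma measurable_coord (R : realType) (n : nat) (i : 'I_n) :
  measurable_fun [set: borel R n] (fun xi : borel R n => (xi : 'cV[R]_n) i 0).
Proof.
(* Open intervals generate the Borel sets of the line, and their preimages under a continuous
   coordinate are open. *)
apply: (measurability _ (RGenOpens.measurableE R)).
move=> _ [_ [a [b ->] <-]]; rewrite setTI; apply: sub_sigma_algebra.
have /continuousP op := @coord_continuous R n 1 i 0.
exact/op/interval_open.
Qed.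

Lemma measurable_dotl (R : realType) (n : nat) (x : 'cV[R]_n) :
  measurable_fun [set: borel R n] (fun xi : borel R n => dot xi x).
Proof.
rewrite (_ : (fun _ => _) = fun xi : borel R n =>
    \sum_i (xi : 'cV[R]_n) i 0 * x i 0); last by apply/funext => xi; rewrite dotE.
by apply: measurable_sum => i; apply: measurable_funM => //; exact: measurable_coord.
Qed.

Lemma measurable_dist2 (R : realType) (n : nat) :
  measurable_fun [set: borel R n * borel R n]
    (fun p => norm2 ((p.1 : 'cV[R]_n) - p.2)).
Proof.
rewrite (_ : (fun _ => _) = Num.sqrt \o fun p : borel R n * borel R n =>
    \sum_i ((p.1 : 'cV[R]_n) i 0 - (p.2 : 'cV[R]_n) i 0) ^+ 2); last first.
  apply/funext => p /=; rewrite /norm2 dotE; congr Num.sqrt.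
  by apply: eq_bigr => i _; rewrite !mxE expr2.
apply: measurableT_comp.
  by apply: measurable_realfun.continuous_measurable_fun; exact: sqrt_continuous.
apply: measurable_sum => i; apply: measurable_funX; apply: measurable_funB.
  exact: measurableT_comp (measurable_coord i) measurable_fst.
exact: measurableT_comp (measurable_coord i) measurable_snd.
Qed.

(** * Lipschitz and convex functions on the line *)

Lemma lipschitzP (R : realType) (L : R -> R) (K : R) :
  K.-lipschitz (L : R^o -> R^o) ->
  forall s t, `|L s - L t| <= K * `|s - t|.
Proof. by move=> LK s t; apply: (LK (s, t)). Qed.

Lemma lipschitz_const_ge0 (R : realType) (L : R -> R) (K : R) :
  K.-lipschitz (L : R^o -> R^o) -> 0 <= K.
Proof.
move=> /lipschitzP /(_ 1 0); rewrite subr0 normr1 mulr1.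
exact: le_trans (normr_ge0 _).
Qed.

Lemma lipschitz_measurable (R : realType) (L : R -> R) (K : R) :
  K.-lipschitz (L : R^o -> R^o) -> measurable_fun [set: R] L.
Proof.
move=> LK; apply: measurable_realfun.continuous_measurable_fun => x.
have K0 := lipschitz_const_ge0 LK.
apply/cvgrPdist_le => e e0; near=> y.
apply: le_trans (lipschitzP LK x y) _.
(* [K] may be zero, so the division below is by [K + 1]. *)
apply: (@le_trans _ _ ((K + 1) * `|x - y|)).
  by rewrite ler_wpM2r// lerDl.
rewrite -ler_pdivlMl; last by rewrite ltr_wpDl.
near: y; apply: cvgr_dist_le; first exact: cvg_id.
by rewrite mulr_gt0// invr_gt0 ltr_wpDl.
Unshelve. all: by end_near. Qed.

Lemma convex_function_le (R : realType) (L : R -> R) :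
  convex_function setT (L : R^o -> R^o) ->
  forall x y t, 0 <= t <= 1 ->
    L ((1 - t) * x + t * y) <= (1 - t) * L x + t * L y.
Proof.
move=> Lc x y t /andP[t0 t1].
pose i := Itv01 t0 t1.
rewrite [leRHS]addrC [in leLHS]addrC.
by have := Lc i y x (in_setT _) (in_setT _).
Qed.

(** If [L t < L s], convexity makes [L] grow at least linearly along the ray from [t] through [s],
    which eventually exceeds [C]. *)
Lemma convex_bounded_above_cst (R : realType) (L : R -> R) (C : R) :
  convex_function setT (L : R^o -> R^o) -> (forall t, L t <= C) ->
  forall s t, L s = L t.
Proof.
move=> Lc LC.
suff le s t : L s <= L t by move=> s t; apply/eqP; rewrite eq_le !le.
rewrite leNgt; apply/negP => lt; set d := L s - L t.
have d0 : 0 < d by rewrite subr_gt0.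
have [k k1 kd] : exists2 k, 1 <= k & C - L t < k * d.
  exists (`|C - L t| / d + 1); first by rewrite lerDr divr_ge0// ltW.
  by rewrite mulrDl divfK ?gt_eqF// mul1r (le_lt_trans (ler_norm _))// ltrDl.
have k0 : 0 < k by lra.
have k01 : 0 <= k^-1 <= 1 by rewrite invr_ge0 ltW//= invf_le1.
(* The point [s] lies between [t] and [t + k * (s - t)], with weight [k^-1] on the latter, so [L] is
   at least [L t + k * d > C] there. *)
have := convex_function_le Lc t (t + k * (s - t)) k01.
rewrite (_ : (1 - _) * t + _ = s); last by field; rewrite gt_eqF.
have := LC (t + k * (s - t)); set u := L _ => uC.
rewrite -(ler_pM2l k0) mulrDr !mulrA mulrBr mulfV ?gt_eqF// mulr1 mul1r.
by move: kd; rewrite /d; lra.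
Qed.

Lemma robust_cost_fin_cst (R : realType) (n : nat) (L : R -> R) (x : 'cV[R]_n) :
  convex_function setT (L : R^o -> R^o) ->
  (robust_cost (linear_loss L) x < +oo)%E ->
  forall xi, L (dot xi x) = L 0.
Proof.
move=> Lc fin xi; have [->|x0] := eqVneq x 0; first by rewrite dot0r.
have le t : ((L t)%:E <= robust_cost (linear_loss L) x)%E.
  (* For nonzero [x] this multiple of [x] has inner product [t] with [x], so the supremum bounds [L]
     on the whole line. *)
  apply: ereal_sup_ubound; exists ((t / dot x x) *: x) => //=.
  by rewrite /linear_loss dotC dotZr divfK// dot_eq0.
apply: (@convex_bounded_above_cst _ _ (fine (robust_cost (linear_loss L) x))) => // t.
rewrite -lee_fin fineK//; apply/fin_numPlt; rewrite fin andbT.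
exact: lt_le_trans (ltNyr _) (le t).
Qed.

(** * Integration against mixtures, empirical measures and image measures *)

Section mixture.
Context (d : measure_display) (T : measurableType d) (R : realType).
Context (l : {i01 R}) (P Q : probability T R).

Definition mixture : set T -> \bar R :=
  measure_add (mscale (1 - l%:num)%:nng P) (mscale l%:num%:nng Q).

HB.instance Definition _ := Measure.on mixture.

Lemma mixtureE A :
  mixture A = ((1 - l%:num)%:E * P A + l%:num%:E * Q A)%E.
Proof. by rewrite /mixture measure_addE. Qed.

Let mixture_setT : mixture setT = 1%E.
Proof. by rewrite mixtureE !probability_setT !mule1 -EFinD subrK. Qed.

HB.instance Definition _ :=
  Measure_isProbability.Build _ _ _ mixture mixture_setT.

Lemma ge0_integral_mixture (f : T -> \bar R) :
  measurable_fun setT f -> (forall x, 0 <= f x)%E ->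
  (\int[mixture]_x f x =
   (1 - l%:num)%:E * \int[P]_x f x + l%:num%:E * \int[Q]_x f x)%E.
Proof.
move=> mf f0; rewrite ge0_integral_measure_add//.
by rewrite !ge0_integral_mscale.
Qed.

End mixture.

Lemma ge0_integral_empirical (R : realType) (n N : nat)
    (xihat : 'I_N.+1 -> borel R n) (f : borel R n -> R) :
  measurable_fun setT f -> (forall x, 0 <= f x) ->
  (\int[empirical xihat]_x (f x)%:E =
   (N.+1%:R^-1 * \sum_(i < N.+1) f (xihat i))%:E)%E.
Proof.
move=> mf f0; have mEf : measurable_fun setT (EFin \o f) by exact/measurable_EFinP.
rewrite (@eq_measure_integral _ _ _ _ (mscale ((N.+1%:R^-1)%:nng)%R
    (msum (fun k => \d_(xihat (inord k))) N.+1))).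
  rewrite ge0_integral_mscale//= ?ge0_integral_measure_sum//; last first.
    by move=> x _; rewrite lee_fin.
    by move=> x _; rewrite lee_fin.
  rewrite EFinM -sumEFin; congr (_ * _)%E; apply: eq_bigr => i _.
  by rewrite integral_dirac// diracT mul1e inord_val.
move=> A mA _; rewrite /mscale /msum /empirical /=; congr (_ * _)%E.
by apply: eq_bigr => i _; rewrite inord_val.
Qed.

(** With [phi] equal to [fst] or [snd], this turns integrals against a marginal into integrals
    against the coupling. *)
Lemma ge0_integral_image_measure (d1 d2 : measure_display)
    (T1 : measurableType d1) (T2 : measurableType d2) (R : realType)
    (mu : {measure set T1 -> \bar R}) (nu : {measure set T2 -> \bar R})
    (phi : T1 -> T2) (f : T2 -> \bar R) :
  measurable_fun setT phi ->
  (forall A, measurable A -> mu (phi @^-1` A) = nu A) ->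
  measurable_fun setT f -> (forall x, 0 <= f x)%E ->
  (\int[nu]_x f x = \int[mu]_x f (phi x))%E.
Proof.
move=> mphi munu mf f0; rewrite (eq_measure_integral (pushforward mu phi)).
  by rewrite ge0_integral_pushforward.
by move=> A mA _; rewrite -munu.
Qed.

(** * Expectations over the Wasserstein ball *)

Lemma wball_expectation_le (R : realType) (n : nat)
    (P Q : probability (borel R n) R) (rho c : R) (h k : borel R n -> R) :
  measurable_fun setT h -> (forall x, 0 <= h x) ->
  measurable_fun setT k -> (forall x, 0 <= k x) -> 0 <= c ->
  (forall u v, h u <= k v + c * norm2 ((u : 'cV[R]_n) - v)) ->
  wball P rho Q -> ('E_Q[h] <= 'E_P[k] + (c * rho)%:E)%E.
Proof.
move=> mh h0 mk k0 c0 hk WQ; rewrite unlock.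
have c1 : 0 < c + 1 by rewrite ltr_wpDl.
apply/lee_addgt0Pr => e e0.
(* The infimum over couplings need not be attained. The slack [e / (c + 1)] costs at most [e] after
   multiplication by [c], even when [c] is zero. *)
have : (wasserstein1 Q P < (rho + e / (c + 1))%:E)%E.
  by rewrite (le_lt_trans WQ)// lte_fin ltrDl divr_gt0.
move=> /ereal_inf_lt[_ [pi QP <-]] cost.
have mD := @measurable_dist2 R n.
have m1 : measurable_fun setT (fun p : borel R n * borel R n => (k p.2)%:E).
  by apply/measurable_EFinP; exact: (measurableT_comp mk measurable_snd).
have m2 : measurable_fun setT (fun p : borel R n * borel R n =>
    (norm2 ((p.1 : 'cV[R]_n) - p.2))%:E) by exact/measurable_EFinP.
rewrite (@ge0_integral_image_measure _ _ _ _ _ pi Q fst)//; last 2 first.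
- by move=> A /QP[].
- exact/measurable_EFinP.
rewrite (@ge0_integral_image_measure _ _ _ _ _ pi P snd)//; last 2 first.
- by move=> A /QP[].
- exact/measurable_EFinP.
apply: (@le_trans _ _ (\int[pi]_p ((k p.2)%:E
    + c%:E * (norm2 ((p.1 : 'cV[R]_n) - p.2))%:E))%E).
  apply: ge0_le_integral => //=.
  - by move=> p _; rewrite lee_fin.
  - by apply/measurable_EFinP; exact: (measurableT_comp mh measurable_fst).
  - by apply: emeasurable_funD => //; exact: measurable_funeM.
  - by move=> p _; rewrite -EFinM -EFinD lee_fin.
rewrite ge0_integralD//=; last first.
- exact: measurable_funeM.
- by move=> p _; rewrite -EFinM lee_fin mulr_ge0// norm2_ge0.
- by move=> p _; rewrite lee_fin.
rewrite ge0_integralZl_EFin//; last by move=> p _; rewrite lee_fin norm2_ge0.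
rewrite -[leRHS]addeA -EFinD; apply: leeD2l.
apply: (le_trans (lee_wpmul2l _ (ltW cost))); first by rewrite lee_fin.
rewrite -EFinM lee_fin mulrDr lerD2l mulrA ler_pdivrMr//.
by rewrite mulrC ler_wpM2l// ?lerDl// ltW.
Qed.

(** An explicit coupling leaves a fraction [1 - l] of the mass of [P] in place and pairs the
    remaining fraction [l] with the point [a]. *)
Lemma wball_mixture_dirac (R : realType) (n : nat)
    (P : probability (borel R n) R) (a : borel R n) (l : {i01 R}) (r : R) :
  (\int[P]_u (norm2 ((a : 'cV[R]_n) - u))%:E = r%:E)%E ->
  wball P (l%:num * r) (mixture l P (dirac a)).
Proof.
move=> Pr.
have mX : measurable_fun setT (fun u : borel R n => (u, u)).
  exact: measurable_fun_pair.
have mY : measurable_fun setT (fun u : borel R n => (a, u)).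
  exact: measurable_fun_pair.
pose X : {mfun borel R n >-> (borel R n * borel R n)%type} :=
  HB.pack (fun u : borel R n => (u, u)) (isMeasurableFun.Build _ _ _ _ _ mX).
pose Y : {mfun borel R n >-> (borel R n * borel R n)%type} :=
  HB.pack (fun u : borel R n => (a, u)) (isMeasurableFun.Build _ _ _ _ _ mY).
pose pi : probability (borel R n * borel R n)%type R :=
  mixture l (distribution P X) (distribution P Y).
apply: ereal_inf_lbound; exists pi.
  move=> A mA; rewrite /pi /= !mixtureE; split.
    (* The image of [P] under the constant map to [a] is the Dirac mass at [a]: on [A] it is [P] of
       the whole space or of the empty set, according to whether [a] lies in [A]. *)
    congr (_ + _ * _)%E; rewrite -[LHS]/(P [set _ | A a]) -[RHS]/((\1_A a)%:E) indicE.
    have [aA|aA] := boolP (a \in A).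
      transitivity (P setT); last by rewrite probability_setT.
      by congr (P _); rewrite -subTset => u _; exact: set_mem.
    transitivity (P set0); last by rewrite measure0.
    by congr (P _); rewrite -subset0 => u Aa; case/negP: aA; exact: mem_set.
  rewrite -[LHS]/((1 - l%:num)%:E * P A + l%:num%:E * P A)%E.
  by rewrite -ge0_muleDl ?lee_fin ?subr_ge0// -EFinD subrK mul1e.
have mD : measurable_fun setT (fun p : borel R n * borel R n =>
    (norm2 ((p.1 : 'cV[R]_n) - p.2))%:E).
  by apply/measurable_EFinP; exact: measurable_dist2.
have D0 (p : borel R n * borel R n) : (0 <= (norm2 ((p.1 : 'cV[R]_n) - p.2))%:E)%E.
  by rewrite lee_fin norm2_ge0.
(* The diagonal part has zero cost; the other part costs [l * r]. *)
rewrite ge0_integral_mixture// !ge0_integral_distribution//= EFinM -Pr.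
rewrite (eq_integral (cst 0%E)); last by move=> u _ /=; rewrite subrr norm20.
by rewrite integral0 mule0 add0e.
Qed.

Lemma expectation_mixture_dirac (R : realType) (n : nat)
    (P : probability (borel R n) R) (a : borel R n) (l : {i01 R})
    (h : borel R n -> R) :
  measurable_fun setT h -> (forall u, 0 <= h u) ->
  ('E_(mixture l P (dirac a))[h] =
   (1 - l%:num)%:E * 'E_P[h] + (l%:num * h a)%:E)%E.
Proof.
move=> mh h0; have mEh : measurable_fun setT (EFin \o h) by exact/measurable_EFinP.
rewrite unlock ge0_integral_mixture//.
by rewrite integral_dirac// diracT mul1e.
Qed.

Lemma expectation_affine (R : realType) (n : nat)
    (P : probability (borel R n) R) (b c : R) (h : borel R n -> R) :
  measurable_fun setT h -> (forall u, 0 <= h u) -> 0 <= b -> 0 <= c ->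
  ('E_P[fun u => (b * h u + c)%R] = b%:E * 'E_P[h] + c%:E)%E.
Proof.
move=> mh h0 b0 c0.
have mEh : measurable_fun setT (EFin \o h) by exact/measurable_EFinP.
rewrite unlock; under eq_integral do rewrite EFinD EFinM.
rewrite ge0_integralD//.
- rewrite ge0_integralZl_EFin//; last by move=> u _; rewrite lee_fin.
  by congr (_ + _)%E; have := expectation_cst P c; rewrite unlock.
- by move=> u _; rewrite -EFinM lee_fin mulr_ge0.
- exact: measurable_funeM.
Qed.

(** * The bound and the final comparison *)

Lemma path_bound_le_mid (R : realType) (n : nat) (K r : R) (x : 'cV[R]_n)
    (rho : R) :
  0 <= K -> 0 <= rho <= r ->
  path_bound K r x 0 rho <= path_bound K r x 0 (r / 2).
Proof.
move=> K0 /andP[rho0 rhor]; rewrite /path_bound norm20 !mulr0 !addr0.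
apply: ler_wpM2l => //; apply: ler_wpM2r; first exact: norm2_ge0.
have [r0|r0] := eqVneq r 0.
  by rewrite (_ : rho = 0) ?r0 ?mul0r//; apply/eqP; rewrite eq_le rho0 -r0 rhor.
(* Completing the square in the quadratic [rho * (1 - rho / r)]. *)
rewrite -subr_ge0 (_ : _ - _ = (rho - r / 2) ^+ 2 / r); last by field.
by rewrite divr_ge0 ?sqr_ge0// (le_trans rho0).
Qed.

Unset Implicit Arguments.

Theorem proposition1 (R : realType) (n N M : nat)
    (X : set 'cV[R]_n)
    (g : 'I_M -> 'cV[R]_n -> 'cV[R]_n -> \bar R) (gamma : 'I_M -> R)
    (xihat : 'I_N.+1 -> borel R n)
    (L : R -> R) (K : R) (x0 xinf : 'cV[R]_n)
    (X_closed : closed X) (X_convex : convex_set X)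
    (g_closed_convex :
       forall m xi, closed_convex_function (fun x => g m x xi))
    (feasible_nonempty : feasible X g gamma !=set0)
    (L_ge0 : forall t, 0 <= L t)
    (L_convex : convex_function setT (L : R^o -> R^o))
    (L_lipschitz : K.-lipschitz (L : R^o -> R^o))
    (x0_optimal :
       optimal_solution (feasible X g gamma)
         (fun x => 'E_(empirical xihat)[linear_loss L x])%E x0)
    (xinf_optimal :
       optimal_solution (feasible X g gamma)
         (robust_cost (linear_loss L)) xinf) :
  let rbar := mean_norm2 xihat in
  let f := wdro_cost (linear_loss L) (empirical xihat) in
  (forall rho, 0 <= rho <= rbar ->
     (optimal_value (shrinkage_path x0 xinf) (f rho)
        - optimal_value (feasible X g gamma) (f rho)
      <= (path_bound K rbar x0 xinf rho)%:E)%E) /\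
  (xinf = 0 ->
     forall rho, 0 <= rho <= rbar ->
       path_bound K rbar x0 xinf rho <= path_bound K rbar x0 xinf (rbar / 2)).
Proof.
pose P : probability (borel R n) R := empirical xihat; move=> rbar f.
have K0 := lipschitz_const_ge0 L_lipschitz.
split; last first.
  by move=> -> rho rho_rbar; exact: path_bound_le_mid.
move=> rho /andP[rho0 rho_rbar].
have mL x : measurable_fun setT (linear_loss L x : borel R n -> R).
  exact: measurableT_comp (lipschitz_measurable L_lipschitz) (measurable_dotl x).
have Linf xi : L (dot xi xinf) = L 0.
  apply: robust_cost_fin_cst => //.
  by case: xinf_optimal => _ /fin_numPlt/andP[].
have [_ /fineK Ea x0_min] := x0_optimal.
set a := fine _ in Ea.
have rbar0 : 0 <= rbar by exact: le_trans rho_rbar.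
have l0 : 0 <= rho / rbar by rewrite divr_ge0.
have lrbar : rho / rbar * rbar = rho.
  (* When [rbar] is zero, [rho] is zero too, so the identity survives the default value of
     division. *)
  have [r0|/divfK//] := eqVneq rbar 0.
  by rewrite r0 mulr0; apply/eqP; rewrite eq_le rho0 -r0 rho_rbar.
have l1 : rho / rbar <= 1.
  have [->|r0] := eqVneq rbar 0; first by rewrite invr0 mulr0.
  by rewrite ler_pdivrMr ?mul1r// lt0r r0.
pose l := Itv01 l0 l1.
have lE : l%:num = rho / rbar by [].
(* [m] is the level shared by the upper and lower estimates; [s] is the transport price per unit of
   distance at the path point. *)
pose m := (1 - l%:num) * a + l%:num * L 0.
pose s := (1 - l%:num) * K * norm2 x0.
pose o : borel R n := (0 : 'cV[R]_n).
have b0 : 0 <= 1 - l%:num by rewrite subr_ge0.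
have c0 : 0 <= l%:num * L 0 by exact: mulr_ge0.
have s0 : 0 <= s by rewrite !mulr_ge0 ?subr_ge0 ?norm2_ge0.
have upper : (optimal_value (shrinkage_path x0 xinf) (f rho) <= (m + s * rho)%:E)%E.
  apply: (@le_trans _ _ (f rho ((1 - l%:num) *: x0 + l%:num *: xinf))).
    apply: ereal_inf_lbound; exists ((1 - l%:num) *: x0 + l%:num *: xinf) => //.
    by exists l%:num => //=; rewrite in_itv/= l0 l1.
  apply: ge_ereal_sup => _ [Q WQ <-].
  have -> : (m + s * rho)%:E = ('E_P[fun u => ((1 - l%:num) * linear_loss L x0 u
      + l%:num * L 0)%R] + (s * rho)%:E)%E.
    rewrite expectation_affine//; last by move=> u; exact: L_ge0.
    by rewrite -Ea -!EFinM -!EFinD.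
  apply: wball_expectation_le WQ => //.
  - by move=> u; exact: L_ge0.
  - by apply: measurable_funD => //; exact: measurable_funM.
  - by move=> u; rewrite addr_ge0// mulr_ge0 ?subr_ge0//; exact: L_ge0.
  (* Convexity splits the loss along the path, [Linf] makes the [xinf] part constant, and the
     Lipschitz bound with Cauchy-Schwarz controls the [x0] part. *)
  - move=> u v; rewrite /linear_loss dotDr !dotZr.
    apply: le_trans (convex_function_le L_convex _ _ _) _; first by rewrite l0.
    rewrite Linf addrAC lerD2r /s -!mulrA -mulrDr ler_wpM2l ?subr_ge0//.
    rewrite -lerBlDl (le_trans (ler_norm _))// (le_trans (lipschitzP L_lipschitz _ _))//.
    rewrite ler_wpM2l// [leRHS]mulrC.
    rewrite (_ : _ - _ = dot ((u : 'cV[R]_n) - v) x0) ?dot_norm2_le//.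
    by rewrite ![dot _ x0]dotC -[- v]scaleN1r dotDr dotZr mulN1r.
have lower : (m%:E <= optimal_value (feasible X g gamma) (f rho))%E.
  apply: le_ereal_inf_tmp => _ [y Fy <-].
  (* At the origin the loss is [L 0] whatever [y] is; on the empirical part, optimality of [x0]
     gives at least [a]. *)
  have Em : (m%:E <= 'E_(mixture l P (dirac o))[linear_loss L y])%E.
    rewrite expectation_mixture_dirac//; last by move=> u; exact: L_ge0.
    rewrite /m /linear_loss dot0l EFinD leeD2r// EFinM lee_wpmul2l ?lee_fin//.
    by rewrite Ea; exact: x0_min.
  apply: le_trans Em _.
  apply: ereal_sup_ubound; eexists => //.
  (* Moving all of the empirical mass to the origin costs exactly [rbar], the mean sample norm. *)
  rewrite -lrbar; apply: wball_mixture_dirac.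
  under eq_integral do rewrite sub0r norm2N.
  rewrite ge0_integral_empirical//; last by move=> u; exact: norm2_ge0.
  have := measurableT_comp (@measurable_dist2 R n) (pair2_measurable o).
  by congr measurable_fun; apply/funext => u /=; rewrite subr0.
apply: le_trans (leeB upper lower) _.
rewrite -EFinB lee_fin addrC addKr /path_bound /s lE.
rewrite -subr_ge0 (_ : _ - _ = K * (rho ^+ 2 / rbar * norm2 xinf)); last by ring.
exact: mulr_ge0 K0 (mulr_ge0 (divr_ge0 (sqr_ge0 rho) rbar0) (norm2_ge0 xinf)).
Qed.
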